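(* Let $p<q$ be primes satisfying: (i) $p\equiv q\equiv 3\pmod 8$ or $p\equiv q\equiv 7\pmod 8$; (ii) $\gcd(p-1,q-1)=2$; (iii) $q$ is a primitive root modulo $p^2$. Suppose further that a third prime $r$ is a primitive root modulo $p^2$ and modulo $q^2$. Then for each exponent $a\ge1$ there are exponents $b$ and $c$ such that \[ \mathcal{A}_{\{p^a,q^b,r^c\}}=\Big\{\,n\in\mathbb{Z} : -\frac{p^a-1}2\le n\le\frac{p^a+1}2\,\Big\}. \]
   Context: For pairwise coprime positive integers $P,Q,R>2$, the ternary inclusion-exclusion polynomial \[ Q_{\{P,Q,R\}}(x)=\frac{(x^{PQR}-1)(x^P-1)(x^Q-1)(x^R-1)}{(x^{PQ}-1)(x^{QR}-1)(x^{RP}-1)(x-1)} \] is a polynomial with integer coefficients, and $\mathcal{A}_{\{P,Q,R\}}$ denotes the set of its coefficients. For prime powers $P=p^a,Q=q^b,R=r^c$ of distinct primes this is the unitary cyclotomic polynomial $\Phi^*_{p^aq^br^c}$. *)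

(* Defs.v *)
From HB Require Import structures.
From mathcomp Require Import all_boot all_order all_algebra.
Set Implicit Arguments.
Unset Strict Implicit.
Unset Printing Implicit Defensive.
Import Order.TTheory GRing.Theory Num.Theory.
Local Open Scope ring_scope.

(* The multiplicative order of g modulo n is totient n.
   Only meaningful for 1 < n, since 'Z_0 and 'Z_1 denote the integers mod 2. *)
Definition primitive_root_mod (g n : nat) : bool :=
  (totient n).-primitive_root (g%:R : 'Z_n).

(* The divisor is monic, so %/ is the Euclidean quotient over int; the division
   is exact when P, Q, R are pairwise coprime. *)
Definition ternary_incl_excl (P Q R : nat) : {poly int} :=
  (('X^(P * Q * R) - 1) * ('X^P - 1) * ('X^Q - 1) * ('X^R - 1)) %/
  (('X^(P * Q) - 1) * ('X^(Q * R) - 1) * ('X^(R * P) - 1) * ('X - 1)).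

(* Coefficients in degrees 0 up to the degree only: a zero belongs to the set
   only if some coefficient in that range vanishes. *)
Definition coef_set (P Q R : nat) : {pred int} :=
  [pred n : int | n \in (ternary_incl_excl P Q R : seq int)].

(* Main.v *)
(** Put P = p^a = 2s + 1. The primitive root hypotheses allow us to choose
    Q = q^b = 2 mod P and R = r^c > PQ with 2R = -1 mod PQ (2R = 1 if P = 3): by
    the second supplementary law, the indices of 1/2 (or -1/2) modulo P and Q
    have the same parity, and gcd(phi(P), phi(Q)) = 2.

    Write Q = kP + 2. The binary polynomial (X^PQ - 1)(X - 1)/((X^P - 1)(X^Q - 1))
    is the sum of X^(xP + yQ) over x <= ks, y <= s minus the sum of
    X^(xP + yQ - PQ) over x > ks, y > s (0 <= x < Q, 0 <= y < P). Hence the n-th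
    ternary coefficient is a sum, over the exponents z <= n/R of the binary one,
    of [n - Rz mod PQ < P] - [n - Rz - Q mod PQ < P]. For each y exactly one x
    satisfies the first condition, and with wR = -1 mod P (w = 2, or 1 if P = 3)
    the second condition for y + w is the first one for y. So the coefficient is
    a sum of P differences, in {0, 1} for the s + 1 values y <= s and in {-1, 0}
    for the others. The z with n - Rz mod PQ < P form an arithmetic
    progression of difference 2 modulo PQ, so for suitable n cutting at z = ksP + P - 1 attains
    both extremes; moving the cut one step at a time changes the coefficient by
    at most 1, so all intermediate values occur. *)

Require Import Defs.
From HB Require Import structures.
From mathcomp Require Import all_boot all_order all_algebra.
From mathcomp Require Import cyclic.
From mathcomp Require Import zify ring.
Set Implicit Arguments.
Unset Strict Implicit.
Unset Printing Implicit Defensive.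
Import Order.TTheory GRing.Theory Num.Theory.
Local Open Scope ring_scope.

(** * Coefficients of the ternary polynomial *)

Lemma sum_ord_rot (n w : nat) (F : nat -> int) :
  \sum_(y < n) F ((y + w) %% n)%N = \sum_(y < n) F y.
Proof.
case: n => [|n]; first by rewrite !big_ord0.
rewrite [RHS](reindex_inj (addIr (inZp w : 'I_n.+1))).
by apply: eq_bigr => y _ /=; rewrite modnDmr.
Qed.

Lemma sum_ord_single (n m : nat) (F : nat -> int) :
  \sum_(z < n) (z == m :> nat)%:R * F z = (m < n)%N%:R * F m.
Proof.
case: (ltnP m n) => [lt_mn|le_nm].
  rewrite (bigD1 (Ordinal lt_mn)) //= eqxx big1 ?addr0 // => z.
  by rewrite -val_eqE /= => /negPf->; rewrite mul0r.
rewrite mul0r big1 // => z _.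
by rewrite ltn_eqF ?mul0r // (leq_trans _ le_nm).
Qed.

Lemma discrete_ivt (f : nat -> int) (T : nat) (n : int) :
  (forall t, `|f t.+1 - f t| <= 1) -> f 0%N <= n <= f T -> exists t, f t = n.
Proof.
move=> hf; elim: T => [|T IH] /andP[h0 hT]; first by exists 0%N; lia.
have [le_n|gt_n] := lerP n (f T); first by apply: IH; rewrite h0.
by exists T.+1; have := hf T; lia.
Qed.

Section TernaryCoefficients.

Variables s k w P Q R : nat.
Hypotheses (s_gt0 : (0 < s)%N) (k_gt0 : (0 < k)%N).
Hypotheses (defP : P = (2 * s + 1)%N) (defQ : Q = (k * P + 2)%N).
Hypotheses (w_gt0 : (0 < w)%N) (le_ws : (w <= s)%N).
Hypotheses (Rw : (P %| R * w + 1)%N) (coRQ : coprime R Q) (le_PQR : (P * Q <= R)%N).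

(** * The binary polynomial of [P] and [Q] *)

Definition bin_sign (x y : nat) : int :=
  if (x <= k * s)%N then (y <= s)%N%:R else - (s < y)%N%:R.

(** Cells of sign 0 are left unreduced: only their residue modulo [P * Q] is ever needed. In the
    block of sign -1 the truncated subtraction is exact. *)
Definition bin_deg (x y : nat) : nat :=
  if (k * s < x)%N && (s < y)%N then (x * P + y * Q - P * Q)%N
  else (x * P + y * Q)%N.

Definition bin_poly : {poly int} :=
  \sum_(x < Q) \sum_(y < P) bin_sign x y *: 'X^(bin_deg x y).

(** The last identity makes [(k * s).+1] the inverse of [P] modulo [Q] and [s.+1] the inverse of [Q]
    modulo [P]; this is what fixes the corners of the two blocks of exponents. *)
Lemma PQ_facts : [/\ (3 <= P)%N, (P + 2 <= Q)%N, (P + Q <= P * Q)%N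
  & ((k * s).+1 * P + s.+1 * Q = P * Q + 1)%N].
Proof.
have hQ : (P + 2 <= Q)%N by rewrite defQ; nia.
have hP : (3 <= P)%N by lia.
split => //; first nia.
by rewrite defQ defP; lia.
Qed.

Lemma high_high_deg x y : (k * s < x)%N -> (s < y)%N -> (P * Q < x * P + y * Q)%N.
Proof.
move=> hx hy; have [_ _ _ E] := PQ_facts.
have := leq_mul hx (leqnn P); have := leq_mul hy (leqnn Q); lia.
Qed.

Lemma bin_deg_lt x y : (x < Q)%N -> (y < P)%N -> bin_sign x y != 0 ->
  (bin_deg x y < P * Q)%N.
Proof.
rewrite /bin_sign /bin_deg => hx hy; have [_ _ _ E] := PQ_facts.
have h1 := leq_mul hx (leqnn P); have h2 := leq_mul hy (leqnn Q).
case: (leqP x (k * s)) => hxs; case: (leqP y s) => hys //= _; last lia.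
have := leq_mul hxs (leqnn P); have := leq_mul hys (leqnn Q); lia.
Qed.

Lemma bin_polyE : bin_poly * ('X^P - 1) * ('X^Q - 1) = ('X^(P * Q) - 1) * ('X - 1).
Proof.
have [P3 hPQ _ E] := PQ_facts.
pose a := \sum_(x < Q | (x <= k * s)%N) ('X^P : {poly int}) ^+ x.
pose a' := \sum_(x < Q | ~~ (x <= k * s)%N) ('X^P : {poly int}) ^+ x.
pose b := \sum_(y < P | (y <= s)%N) ('X^Q : {poly int}) ^+ y.
pose b' := \sum_(y < P | ~~ (y <= s)%N) ('X^Q : {poly int}) ^+ y.
have geo (n m : nat) (z : {poly int}) : (m < n)%N ->
    (z - 1) * (\sum_(x < n | (x <= m)%N) z ^+ x) = z ^+ m.+1 - 1.
  move=> lt_mn; rewrite subrX1; congr (_ * _).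
  by rewrite (big_ord_widen_cond n xpredT (fun i => z ^+ i)).
have geo' (n m : nat) (z : {poly int}) : (m < n)%N ->
    (z - 1) * (\sum_(x < n | ~~ (x <= m)%N) z ^+ x) = z ^+ n - z ^+ m.+1.
  move=> lt_mn; have := subrX1 z n.
  rewrite (bigID (fun x : 'I_n => (x <= m)%N)) /= mulrDr geo // => e.
  by apply: (addrI (z ^+ m.+1 - 1)); rewrite -e; ring.
have lt1 : (k * s < Q)%N by rewrite defQ; nia.
have lt2 : (s < P)%N by lia.
have Ea := geo _ _ 'X^P lt1; have Eb := geo _ _ 'X^Q lt2.
have Ea' := geo' _ _ 'X^P lt1; have Eb' := geo' _ _ 'X^Q lt2.
rewrite -/a -/b -/a' -/b' -!exprM [in 'X^(Q * P)]mulnC in Ea Eb Ea' Eb'.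
(* Multiplying by ['X^(P * Q)] removes the subtraction from the exponents, so that each block
   factors into two geometric sums. *)
have dec : 'X^(P * Q) * bin_poly = 'X^(P * Q) * (a * b) - a' * b'.
  rewrite /bin_poly /a /b /a' /b' !big_distrlr /= !mulr_sumr -sumrN.
  rewrite [LHS](bigID (fun x : 'I_Q => (x <= k * s)%N)) /=; congr (_ + _).
    apply: eq_bigr => x hx; rewrite !mulr_sumr.
    rewrite [LHS](bigID (fun y : 'I_P => (y <= s)%N)) /= [X in _ + X]big1 ?addr0.
      apply: eq_bigr => y hy; rewrite /bin_sign /bin_deg hx hy ltnNge hx /= scale1r.
      by rewrite -!exprM -!exprD; congr ('X^_); lia.
    by move=> y hy; rewrite /bin_sign hx (negPf hy) scale0r mulr0.
  apply: eq_bigr => x hx; rewrite mulr_sumr -sumrN.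
  rewrite [LHS](bigID (fun y : 'I_P => (y <= s)%N)) /= [X in X + _]big1 ?add0r.
    apply: eq_bigr => y hy; rewrite -!ltnNge in hx hy.
    rewrite /bin_sign /bin_deg leqNgt hx hy /= scaleN1r -!exprM mulrN -!exprD.
    by have h := high_high_deg hx hy; congr (- 'X^_); lia.
  by move=> y hy; rewrite /bin_sign (negPf hx) ltnNge hy oppr0 scale0r mulr0.
apply: (@mulfI _ ('X^(P * Q))); first by rewrite -size_poly_gt0 size_polyXn.
rewrite !mulrA dec.
(* The corner exponents add up to [P * Q + 1]; this produces the factor ['X - 1]. *)
have e1 : 'X^(P * (k * s).+1) * 'X^(Q * s.+1) = 'X^(P * Q) * 'X :> {poly int}.
  by rewrite -exprD -exprSr; congr ('X^_); lia.
transitivity ('X^(P * Q) * (('X^P - 1) * a) * (('X^Q - 1) * b)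
              - (('X^P - 1) * a') * (('X^Q - 1) * b')); first by ring.
rewrite Ea Eb Ea' Eb'; move: ('X^(P * (k * s).+1)) ('X^(Q * s.+1)) e1 => u v e1.
transitivity (('X^(P * Q) - 1) * (u * v) + 'X^(P * Q) * (1 - 'X^(P * Q))); first by ring.
by rewrite e1; ring.
Qed.

Lemma modn_invP : ((k * s).+1 * P = s * Q + 1)%N.
Proof. by rewrite defQ defP; lia. Qed.

Lemma modn_invQ : (s.+1 * Q = (s.+1 * k + 1) * P + 1)%N.
Proof. by rewrite defQ defP; lia. Qed.

(** Multiplication by the inverse of [P] modulo [Q] decodes [x]. Together with the analogous
    decoding of [y], it shows that distinct cells have distinct exponents, so no two terms of the
    binary polynomial collide. *)
Lemma bin_deg_residueQ x y : (x < Q)%N -> ((bin_deg x y * (k * s).+1) %% Q = x)%N.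
Proof.
move=> hx; have h : ((x * P + y * Q) * (k * s).+1 = (x * s + y * (k * s).+1) * Q + x)%N.
  by rewrite mulnDl -mulnA [(P * _)%N]mulnC modn_invP; lia.
rewrite /bin_deg; case: ifP => [/andP[hx' hy']|_]; last first.
  by rewrite h modnMDl modn_small.
have lt := high_high_deg hx' hy'.
rewrite -(modnMDl (P * (k * s).+1)).
have -> : (P * (k * s).+1 * Q + (x * P + y * Q - P * Q) * (k * s).+1 =
           (x * P + y * Q) * (k * s).+1)%N.
  rewrite mulnBl; have := leq_mul (ltnW lt) (leqnn (k * s).+1); lia.
by rewrite h modnMDl modn_small.
Qed.

Lemma bin_deg_residueP x y : (y < P)%N -> ((bin_deg x y * s.+1) %% P = y)%N.
Proof.
move=> hy; have h : ((x * P + y * Q) * s.+1 = (x * s.+1 + y * (s.+1 * k + 1)) * P + y)%N.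
  by rewrite mulnDl -(mulnA y) [(Q * _)%N]mulnC modn_invQ; lia.
rewrite /bin_deg; case: ifP => [/andP[hx' hy']|_]; last first.
  by rewrite h modnMDl modn_small.
have lt := high_high_deg hx' hy'.
rewrite -(modnMDl (Q * s.+1)).
have -> : (Q * s.+1 * P + (x * P + y * Q - P * Q) * s.+1 =
           (x * P + y * Q) * s.+1)%N.
  rewrite mulnBl; have := leq_mul (ltnW lt) (leqnn s.+1); lia.
by rewrite h modnMDl modn_small.
Qed.

Lemma coef_bin_poly z :
  bin_poly`_z = \sum_(x < Q) \sum_(y < P) (z == bin_deg x y)%:R * bin_sign x y.
Proof.
rewrite /bin_poly coef_sum; apply: eq_bigr => x _.
by rewrite coef_sum; apply: eq_bigr => y _; rewrite coefZ coefXn mulrC.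
Qed.

Lemma norm_coef_bin_poly z : `|bin_poly`_z| <= 1.
Proof.
rewrite coef_bin_poly pair_bigA /=.
case: (pickP (fun q : 'I_Q * 'I_P => z == bin_deg q.1 q.2)) => [q /eqP Eq|none].
  rewrite (bigD1 q) //= big1 ?addr0 => [|q' ne_q'q]; last first.
    case: eqP => [Ez|]; last by rewrite mul0r.
    case/eqP: ne_q'q; rewrite [q]surjective_pairing [q']surjective_pairing.
    congr (_, _); apply: val_inj => /=.
      by rewrite -(bin_deg_residueQ q'.2 (ltn_ord q'.1)) -Ez Eq bin_deg_residueQ.
    by rewrite -(bin_deg_residueP q'.1 (ltn_ord q'.2)) -Ez Eq bin_deg_residueP.
  rewrite -Eq eqxx mul1r /bin_sign.
  by case: ifP => _; [case: (_ <= s)%N | case: (s < _)%N].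
by rewrite big1 ?normr0 // => q _; rewrite none mul0r.
Qed.

(** * Truncated coefficients as sums over residue windows modulo [P * Q] *)

Definition window (j : int) : bool := (j %% (P * Q)%N%:Z)%Z < P%:Z.

Lemma windowD (j m : int) : window (j + m * (P * Q)%N%:Z) = window j.
Proof. by rewrite /window addrC modzMDl. Qed.

(* The n-th ternary coefficient is [trunc_coef n (n %/ R).+1]; the residue class
   of [c] modulo [P * Q] and the cut [t] are independent since [P * Q <= R]. *)
Definition trunc_coef (c : int) (t : nat) : int :=
  \sum_(z < t) bin_poly`_z *
    ((window (c - (R * z)%N%:Z))%:R - (window (c - (R * z)%N%:Z - Q%:Z))%:R).

Lemma trunc_coef_step c t : `|trunc_coef c t.+1 - trunc_coef c t| <= 1.
Proof.
rewrite /trunc_coef big_ord_recr /= addrAC subrr add0r normrM.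
have le1 := norm_coef_bin_poly t.
case: (window _); case: (window _);
  by rewrite ?subrr ?subr0 ?sub0r ?normrN ?normr0 ?mulr0 ?normr1 ?mulr1.
Qed.

Definition trunc_sign (t x y : nat) : int :=
  if (bin_deg x y < t)%N then bin_sign x y else 0.

(** The contribution of row [y] once the second window has been reindexed by the shift [w], so that
    both terms carry the same window condition. *)
Definition sign_diff (t x y : nat) : int :=
  trunc_sign t x y - trunc_sign t x ((y + w) %% P).

Lemma sum_bin_poly (t : nat) (F : nat -> int) :
  \sum_(z < t) bin_poly`_z * F z =
  \sum_(x < Q) \sum_(y < P) trunc_sign t x y * F (bin_deg x y).
Proof.
under eq_bigr do rewrite coef_bin_poly mulr_suml.
rewrite exchange_big; apply: eq_bigr => x _.
under eq_bigr do rewrite mulr_suml.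
rewrite exchange_big; apply: eq_bigr => y _.
under eq_bigr do rewrite -mulrA.
rewrite (sum_ord_single t (bin_deg x y) (fun z => bin_sign x y * F z)).
by rewrite /trunc_sign; case: ifP => _; rewrite ?mul1r ?mul0r.
Qed.

Lemma window_bin_deg (c : int) x y :
  window (c - (R * bin_deg x y)%N%:Z) = window (c - (R * (x * P + y * Q))%N%:Z).
Proof.
rewrite /bin_deg; case: ifP => // /andP[hx hy].
have lt := high_high_deg hx hy.
rewrite -(windowD (c - (R * (x * P + y * Q))%N%:Z) R); congr window.
by rewrite -{2}(subnK (ltnW lt)) mulnDr; lia.
Qed.

Lemma trunc_coefE c t :
  trunc_coef c t = \sum_(y < P) \sum_(x < Q)
    (window (c - (R * (x * P + y * Q))%N%:Z))%:R * sign_diff t x y.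
Proof.
rewrite /trunc_coef (sum_bin_poly t (fun z =>
  (window (c - (R * z)%N%:Z))%:R - (window (c - (R * z)%N%:Z - Q%:Z))%:R)).
rewrite [RHS]exchange_big; apply: eq_bigr => x _.
under [LHS]eq_bigr do rewrite mulrBr.
under [RHS]eq_bigr do rewrite mulrBr.
rewrite !sumrB; congr (_ - _).
  by apply: eq_bigr => y _; rewrite mulrC window_bin_deg.
rewrite -(sum_ord_rot P w (fun y =>
  trunc_sign t x y * (window (c - (R * bin_deg x y)%N%:Z - Q%:Z))%:R)).
apply: eq_bigr => y _; rewrite mulrC; congr (_%:R * _).
rewrite addrAC window_bin_deg.
(* From [R * w + 1 = u * P], passing from [y] to [y + w] and removing the extra shift by [Q] changes
   the argument by [u * (P * Q)]; [d] accounts for the wrap-around past [P]. *)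
have /dvdnP[u Eu] := Rw.
pose d := ((y + w) %/ P)%N.
rewrite -(windowD _ (u%:Z - (R * d)%N%:Z)).
congr (window _).
have := divn_eq (y + w) P; rewrite -/d; nia.
Qed.

Lemma window_dvd (d m : int) : 0 <= m < P%:Z -> window (d * P%:Z + m) = (Q %| d)%Z.
Proof.
move=> /andP[m0 mP]; have [P3 hPQ _ _] := PQ_facts.
have Q0 : Q%:Z != 0 by lia.
have f0 := modz_ge0 d Q0; have fQ : (d %% Q)%Z < Q%:Z by apply: ltz_pmod; lia.
rewrite /window {1}(divz_eq d Q%:Z).
have -> : ((d %/ Q)%Z * Q%:Z + (d %% Q)%Z) * P%:Z + m =
   (d %/ Q)%Z * (P * Q)%N%:Z + ((d %% Q)%Z * P%:Z + m) by rewrite PoszM; ring.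
rewrite modzMDl modz_small; last by rewrite PoszM; nia.
by apply/idP/dvdz_mod0P => [h|->]; nia.
Qed.

(** For fixed [y] the argument is [(d - R * x) * P] plus a remainder below [P], so the condition
    reads [R * x = d] modulo [Q], which is solvable uniquely because [R] is invertible there. *)
Lemma window_unique (c : int) (y : nat) :
  exists x0 : 'I_Q, forall x : 'I_Q,
    window (c - (R * (x * P + y * Q))%N%:Z) = (x == x0).
Proof.
have [P3 hPQ _ _] := PQ_facts.
have Q0 : Q%:Z != 0 by lia.
have P0 : P%:Z != 0 by lia.
pose c' := c - (R * y * Q)%N%:Z.
pose d := (c' %/ P%:Z)%Z.
have [u [v uv]] : exists u v : int, u * R%:Z + v * Q%:Z = 1.
  have [u [v uv]] := Bezoutz R%:Z Q%:Z; exists u, v; rewrite uv.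
  by move/eqP: coRQ => h; rewrite /gcdz /= h.
have f0 := modz_ge0 (u * d) Q0.
have fQ : ((u * d) %% Q)%Z < Q%:Z by apply: ltz_pmod; lia.
have lt_x0 : (`|((u * d) %% Q)%Z|%N < Q)%N by lia.
exists (Ordinal lt_x0) => x; rewrite -val_eqE /=.
have -> : c - (R * (x * P + y * Q))%N%:Z = (d - (R * x)%N%:Z) * P%:Z + (c' %% P%:Z)%Z.
  have := divz_eq c' P%:Z; rewrite -/d {1}/c' => e.
  have -> : c = (d * P%:Z + (c' %% P%:Z)%Z) + (R * y * Q)%N%:Z by rewrite -e subrK.
  by rewrite !(PoszM, PoszD); ring.
rewrite window_dvd; last by rewrite modz_ge0 //= ltz_pmod //; lia.
have hx := ltn_ord x.
have -> : (Q %| d - (R * x)%N%:Z)%Z = (Q %| u * d - x%:Z)%Z.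
  apply/idP/idP => h.
    have -> : u * d - x%:Z = u * (d - (R * x)%N%:Z) - v * x%:Z * Q%:Z.
      have {1}-> : x%:Z = x%:Z * (u * R%:Z + v * Q%:Z) by rewrite uv mulr1.
      by rewrite PoszM; ring.
    by rewrite rpredB ?dvdz_mull.
  have -> : d - (R * x)%N%:Z = R%:Z * (u * d - x%:Z) + v * d * Q%:Z.
    have {1}-> : d = d * (u * R%:Z + v * Q%:Z) by rewrite uv mulr1.
    by rewrite PoszM; ring.
  by rewrite rpredD ?dvdz_mull.
rewrite -eqz_mod_dvd (modz_small (m := x%:Z)); last by lia.
by apply/eqP/eqP; lia.
Qed.

Lemma trunc_coef_choice c t : exists X : 'I_P -> 'I_Q,
  (forall (y : 'I_P) (x : 'I_Q),
     window (c - (R * (x * P + y * Q))%N%:Z) -> x = X y) /\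
  trunc_coef c t = \sum_(y < P) sign_diff t (X y) y.
Proof.
have [X hX] := fin_all_exists (fun y : 'I_P => window_unique c y).
exists X; split=> [y x|]; first by rewrite hX => /eqP.
rewrite trunc_coefE; apply: eq_bigr => y _.
rewrite (bigD1 (X y)) //= hX eqxx mul1r big1 ?addr0 // => x /negPf ne.
by rewrite hX ne mul0r.
Qed.

(** * Bounds for the truncated coefficients *)

Lemma sign_diff_low t x y : (x < Q)%N -> (y <= s)%N -> 0 <= sign_diff t x y <= 1.
Proof.
move=> hx hy; rewrite /sign_diff /trunc_sign modn_small; last by lia.
rewrite /bin_sign /bin_deg hy; case: (leqP x (k * s)) => hxs /=.
  case: (leqP (y + w) s) => hyw; last by do 2!case: ifP.
  (* Exponents grow with [y], so a cut that keeps the term of [y + w] also keeps that of [y], and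
     the two cancel. *)
  have le_deg : (x * P + y * Q <= x * P + (y + w) * Q)%N.
    by rewrite leq_add2l leq_mul2r leq_addr orbT.
  case: (ltnP (x * P + (y + w) * Q) t) => h1; last by case: ifP.
  by rewrite (leq_ltn_trans le_deg h1) subrr.
rewrite (ltnNge s y) hy /= oppr0.
case: (leqP (y + w) s) => hyw /=; first by rewrite oppr0 !if_same subr0.
by rewrite if_same; case: ifP.
Qed.

Lemma sign_diff_high t x y : (x < Q)%N -> (s < y < P)%N -> -1 <= sign_diff t x y <= 0.
Proof.
move=> hx /andP[hy hyP]; rewrite /sign_diff /trunc_sign /bin_sign /bin_deg.
rewrite (leqNgt y) hy /=.
case: (ltnP (y + w) P) => hyw.
  rewrite modn_small // (leqNgt (y + w)).
  have hy' : (s < y + w)%N by lia.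
  rewrite hy' /=; case: (leqP x (k * s)) => hxs /=; first by rewrite !if_same.
  have le_deg : (x * P + y * Q - P * Q <= x * P + (y + w) * Q - P * Q)%N.
    by apply: leq_sub2r; rewrite leq_add2l leq_mul2r leq_addr orbT.
  case: (ltnP (x * P + (y + w) * Q - P * Q) t) => h1; last by case: ifP.
  by rewrite (leq_ltn_trans le_deg h1) subrr.
have -> : ((y + w) %% P = y + w - P)%N.
  by rewrite -{1}(subnK hyw) modnDr modn_small //; lia.
have hy' : (y + w - P <= s)%N by lia.
rewrite hy' (ltnNge s (y + w - P)) hy' /=.
by case: (leqP x (k * s)) => hxs /=; rewrite ?oppr0 ?if_same; case: ifP.
Qed.

Lemma sum_low_high (a b : int) :
  \sum_(y < P) (if (y <= s)%N then a else b) = s.+1%:Z * a + s%:Z * b.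
Proof.
have -> : P = (s.+1 + s)%N by lia.
rewrite big_split_ord /=; congr (_ + _).
  rewrite (eq_bigr (fun=> a)) => [|y _]; first by rewrite sumr_const card_ord -mulr_natl natz.
  by rewrite -ltnS ltn_ord.
rewrite (eq_bigr (fun=> b)) => [|y _]; first by rewrite sumr_const card_ord -mulr_natl natz.
by rewrite leqNgt ltnS leq_addr.
Qed.

Lemma trunc_coef_bound c t : - s%:Z <= trunc_coef c t <= s.+1%:Z.
Proof.
have [X [_ ->]] := trunc_coef_choice c t; apply/andP; split.
  have <- : \sum_(y < P) (if (y <= s)%N then 0 else -1) = - s%:Z by rewrite sum_low_high; lia.
  apply: ler_sum => y _; case: (leqP y s) => hy.
    by case/andP: (sign_diff_low t (ltn_ord (X y)) hy).
  by have := @sign_diff_high t (X y) y (ltn_ord _); rewrite hy ltn_ord => /(_ isT)/andP[].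
have <- : \sum_(y < P) (if (y <= s)%N then 1 else 0) = s.+1%:Z by rewrite sum_low_high; lia.
apply: ler_sum => y _; case: (leqP y s) => hy.
  by case/andP: (sign_diff_low t (ltn_ord (X y)) hy).
by have := @sign_diff_high t (X y) y (ltn_ord _); rewrite hy ltn_ord => /(_ isT)/andP[].
Qed.

(** Beyond all exponents nothing is cut off. Since the full sign is [[y <= s] - [k * s < x]], the
    difference for a row no longer depends on [x] and cancels in the cyclic sum over [y]. *)
Lemma trunc_coef_eq0 c t : (P * Q <= t)%N -> trunc_coef c t = 0.
Proof.
move=> le_t; have [X [_ ->]] := trunc_coef_choice c t.
have P_gt0 : (0 < P)%N by lia.
have Es (y : 'I_P) : sign_diff t (X y) y =
    (y <= s)%N%:R - ((y + w) %% P <= s)%N%:R.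
  have E z : (z < P)%N -> trunc_sign t (X y) z = bin_sign (X y) z.
    move=> hz; rewrite /trunc_sign; case: ifPn => // /negP h.
    apply/eqP; rewrite eq_sym; apply/negPn/negP => ne; apply: h.
    by apply: leq_trans (bin_deg_lt (ltn_ord _) hz ne) le_t.
  rewrite /sign_diff !E ?ltn_pmod // /bin_sign.
  by case: ifP => // _; rewrite !(ltnNge s); do 2!case: (_ <= s)%N.
rewrite (eq_bigr _ (fun y _ => Es y)) sumrB.
by rewrite (sum_ord_rot P w (fun y => (y <= s)%N%:R)) subrr.
Qed.

(** * Attaining the two extreme values *)

Lemma window_degD (c : int) (z : nat) :
  window (c - (R * (z + P * Q))%N%:Z) = window (c - (R * z)%N%:Z).
Proof.
rewrite -(windowD (c - (R * (z + P * Q))%N%:Z) R); congr window.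
by rewrite mulnDr; lia.
Qed.

(** The progression is hit in row [y] by [k * s * P + 2 * y], which is
    [(k * s - k * y) * P + y * Q]. As [P = 2 * s + 1], the cut at [k * s * P + P] keeps exactly the
    rows with [y <= s], and a further [w * Q] always passes it. *)
Lemma trunc_coef_max c :
  (forall m, (m < P)%N -> window (c - (R * (k * s * P + 2 * m))%N%:Z)) ->
  trunc_coef c (k * s * P + P) = s.+1%:Z.
Proof.
move=> hc; have [X [hX ->]] := trunc_coef_choice c (k * s * P + P).
have [P3 hPQ _ _] := PQ_facts.
transitivity (\sum_(y < P) (if (y <= s)%N then 1 else 0 : int)); last first.
  by rewrite sum_low_high; lia.
apply: eq_bigr => y _; have hyP := ltn_ord y; have hw : (Q <= w * Q)%N by rewrite leq_pmull.
have Ey z : (z * Q = k * z * P + 2 * z)%N by rewrite defQ; lia.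
case: (leqP y s) => hy.
  have le_ky : (k * y <= k * s)%N by rewrite leq_mul2l hy orbT.
  have lt_x : (k * s - k * y < Q)%N by rewrite defQ; nia.
  have Ex : ((k * s - k * y) * P + k * y * P = k * s * P)%N by rewrite -mulnDl subnK.
  rewrite -(hX y (Ordinal lt_x)) /=; last first.
    have -> : ((k * s - k * y) * P + y * Q = k * s * P + 2 * y)%N by rewrite Ey; lia.
    exact: hc.
  rewrite /sign_diff /trunc_sign /bin_sign /bin_deg (ltnNge (k * s)) leq_subr hy /=.
  rewrite modn_small; last by lia.
  have -> : ((k * s - k * y) * P + y * Q < k * s * P + P)%N by have := Ey y; lia.
  have /negPf-> : ~~ ((k * s - k * y) * P + (y + w) * Q < k * s * P + P)%N.
    by have := Ey y; rewrite mulnDl; lia.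
  by rewrite subr0.
have le_ky : (k * y <= k * P)%N by rewrite leq_mul2l (ltnW hyP) orbT.
have lt_ky : (k * s < k * y)%N by rewrite ltn_mul2l k_gt0.
(* The same point of the progression, with [x] shifted by [Q] to be nonnegative; the exponent gains
   [P * Q]. *)
pose x := (k * s + (Q - k * y))%N.
have lt_x : (x < Q)%N by rewrite /x; lia.
have gt_x : (k * s < x)%N by rewrite /x; lia.
have Ex : (x * P + k * y * P = k * s * P + P * Q)%N.
  by rewrite [(P * Q)%N]mulnC -!mulnDl; congr (_ * _)%N; rewrite /x; lia.
rewrite -(hX y (Ordinal lt_x)) /=; last first.
  have -> : (x * P + y * Q = k * s * P + 2 * y + P * Q)%N by rewrite Ey; lia.
  by rewrite window_degD; apply: hc.
have tr z : (y <= z)%N -> trunc_sign (k * s * P + P) x z = 0.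
  move=> le_yz; rewrite /trunc_sign /bin_deg /bin_sign gt_x (leq_trans hy le_yz) /=.
  have /negPf-> // : ~~ (x * P + z * Q - P * Q < k * s * P + P)%N.
  by have := Ey y; have := leq_mul le_yz (leqnn Q); lia.
rewrite /sign_diff tr // sub0r; case: (ltnP (y + w) P) => hyw.
  by rewrite modn_small // tr ?oppr0 // leq_addr.
have -> : ((y + w) %% P = y + w - P)%N.
  by rewrite -{1}(subnK hyw) modnDr modn_small //; lia.
rewrite /trunc_sign /bin_sign (leqNgt x) gt_x /=.
have /negPf-> : ~~ (s < y + w - P)%N by lia.
by rewrite /= ?oppr0 if_same.
Qed.

(** Starting the progression one unit later swaps the roles: rows with [y <= s] meet it at
    [k * s * P + P + 2 * y], past the cut, and the others at [k * s * P + 2 * y - P], before it. *)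
Lemma trunc_coef_min c :
  (forall m, (m < P)%N -> window (c - (R * (k * s * P + 1 + 2 * m))%N%:Z)) ->
  trunc_coef c (k * s * P + P) = - s%:Z.
Proof.
move=> hc; have [X [hX ->]] := trunc_coef_choice c (k * s * P + P).
have [P3 hPQ _ _] := PQ_facts.
transitivity (\sum_(y < P) (if (y <= s)%N then 0 else -1 : int)); last first.
  by rewrite sum_low_high; lia.
apply: eq_bigr => y _; have hyP := ltn_ord y; have hw : (Q <= w * Q)%N by rewrite leq_pmull.
have Ey z : (z * Q = k * z * P + 2 * z)%N by rewrite defQ; lia.
case: (leqP y s) => hy.
  have le_ky : (k * y <= k * s)%N by rewrite leq_mul2l hy orbT.
  pose x := (k * s + 1 - k * y)%N.
  have lt_x : (x < Q)%N by rewrite /x defQ; nia.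
  have Ex : (x * P + k * y * P = k * s * P + P)%N.
    by rewrite -mulnDl subnK ?mulnDl ?mul1n //; lia.
  rewrite -(hX y (Ordinal lt_x)) /=; last first.
    have -> : (x * P + y * Q = k * s * P + 1 + 2 * (y + s))%N by rewrite Ey; lia.
    by apply: hc; lia.
  (* Row 0 is exceptional: there [x = k * s + 1] lies in the upper range, and the term vanishes by
     its sign rather than by the cut. *)
  have tr z : (y <= z)%N -> (z < P)%N -> ((y == 0 :> nat) -> z <= s)%N ->
      trunc_sign (k * s * P + P) x z = 0.
    move=> le_yz lt_zP hz; rewrite /trunc_sign /bin_deg /bin_sign.
    case: (leqP x (k * s)) => hx /=.
      have /negPf-> // : ~~ (x * P + z * Q < k * s * P + P)%N.
      by have := Ey y; have := leq_mul le_yz (leqnn Q); lia.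
    have y0 : (y == 0 :> nat)%N.
      by case: (posnP y) => // y_gt0; move: hx; rewrite /x; have := leq_mul k_gt0 y_gt0; lia.
    by rewrite (ltnNge s z) hz //= oppr0 if_same.
  by rewrite /sign_diff modn_small; last lia; rewrite !tr ?subrr //; lia.
have le_ky : (k + k * y <= k * P)%N by rewrite -mulnS leq_mul2l hyP orbT.
pose x := (k * s + (Q - 1 - k * y))%N.
have lt_ky : (k * s < k * y)%N by rewrite ltn_mul2l k_gt0.
have lt_x : (x < Q)%N by rewrite /x; lia.
have gt_x : (k * s < x)%N by rewrite /x; lia.
have Ex : (x * P + k * y * P + P = k * s * P + P * Q)%N.
  rewrite [(P * Q)%N]mulnC -[X in (_ + X = _)%N]mul1n -!mulnDl; congr (_ * _)%N; rewrite /x; lia.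
rewrite -(hX y (Ordinal lt_x)) /=; last first.
  have -> : (x * P + y * Q = k * s * P + 1 + 2 * (y - s.+1) + P * Q)%N by rewrite Ey; lia.
  by rewrite window_degD; apply: hc; lia.
rewrite /sign_diff; have -> : trunc_sign (k * s * P + P) x y = -1.
  rewrite /trunc_sign /bin_deg /bin_sign gt_x hy (leqNgt x) gt_x /=.
  by have -> : (x * P + y * Q - P * Q < k * s * P + P)%N by have := Ey y; lia.
suff -> : trunc_sign (k * s * P + P) x ((y + w) %% P) = 0 by rewrite subr0.
rewrite /trunc_sign /bin_deg /bin_sign gt_x (leqNgt x) gt_x /=.
case: (ltnP (y + w) P) => hyw.
  rewrite modn_small //; have -> /= : (s < y + w)%N by lia.
  have /negPf-> // : ~~ (x * P + (y + w) * Q - P * Q < k * s * P + P)%N.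
  by have := Ey y; rewrite mulnDl; lia.
have -> : ((y + w) %% P = y + w - P)%N.
  by rewrite -{1}(subnK hyw) modnDr modn_small //; lia.
have /negPf-> : ~~ (s < y + w - P)%N by lia.
by rewrite /= ?oppr0 if_same.
Qed.

(** * Identification with the ternary polynomial *)

Lemma window_small j : (j < P * Q)%N -> window j%:Z = (j < P)%N.
Proof. by move=> h; rewrite /window modz_small ?ltz_nat. Qed.

Lemma window_smallB j : (j < P * Q)%N -> window (j%:Z - Q%:Z) = (Q <= j < Q + P)%N.
Proof.
move=> h; have [P3 hPQ hS _] := PQ_facts.
case: (leqP Q j) => hj /=.
  have -> : j%:Z - Q%:Z = (j - Q)%N%:Z by lia.
  by rewrite window_small; lia.
rewrite -(windowD _ 1) mul1r.
have -> : j%:Z - Q%:Z + (P * Q)%N%:Z = (j + P * Q - Q)%N%:Z by lia.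
by rewrite window_small; lia.
Qed.

Lemma trunc_coefD c m t : trunc_coef (c + m * (P * Q)%N%:Z) t = trunc_coef c t.
Proof.
apply: eq_bigr => z _; congr (_ * (_%:R - _%:R)).
  by congr nat_of_bool; rewrite -[RHS](windowD _ m); congr window; ring.
by congr nat_of_bool; rewrite -[RHS](windowD _ m); congr window; ring.
Qed.

(** The degree bound is only a convenient one: from there on the coefficient formula gives 0
    anyway. *)
Definition ternary_poly : {poly int} :=
  \poly_(n < R * (P * Q)) trunc_coef n%:Z (n %/ R).+1.

Lemma R_gt0 : (0 < R)%N.
Proof. by have [? ? ? _] := PQ_facts; apply: leq_trans le_PQR; lia. Qed.

Lemma coef_ternary_poly n : ternary_poly`_n = trunc_coef n%:Z (n %/ R).+1.
Proof.
rewrite coef_poly; case: ifPn => //; rewrite -leqNgt => h.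
rewrite trunc_coef_eq0 // leqW //.
by rewrite leq_divRL ?R_gt0 // mulnC.
Qed.

Lemma trunc_coef_widen c n N : (n %/ R < N)%N ->
  trunc_coef c (n %/ R).+1 = \sum_(z < N) (if (R * z <= n)%N then
     bin_poly`_z * ((window (c - (R * z)%N%:Z))%:R
                    - (window (c - (R * z)%N%:Z - Q%:Z))%:R) else 0).
Proof.
move=> hN; rewrite -big_mkcond /= /trunc_coef.
rewrite (big_ord_widen N (fun z => bin_poly`_z * ((window (c - (R * z)%N%:Z))%:R
                    - (window (c - (R * z)%N%:Z - Q%:Z))%:R)) hN).
by apply: eq_bigl => z; rewrite ltnS leq_divRL ?R_gt0 // mulnC.
Qed.

(** Windows are the coefficients of the geometric sum of length [P] divided by [1 - 'X^(P * Q)]. By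
    periodicity, subtracting the coefficient at [n - P * Q] leaves only the [z] with
    [0 <= n - R * z < P * Q]. *)
Lemma ternary_polyE : ternary_poly * (1 - 'X^(P * Q)) =
  (\sum_(m < P) 'X^m) * (1 - 'X^Q) * (bin_poly \Po 'X^R).
Proof.
have [P3 hPQ hS _] := PQ_facts.
apply/polyP => n.
pose N := (size bin_poly + n.+1)%N.
have -> : bin_poly \Po 'X^R = \sum_(z < N) bin_poly`_z *: 'X^(R * z).
  rewrite comp_polyE (big_ord_widen N (fun i => bin_poly`_i *: 'X^R ^+ i)) ?leq_addr //.
  rewrite big_mkcond; apply: eq_bigr => z _; rewrite -exprM; case: ifPn => //.
  by rewrite -leqNgt => h; rewrite nth_default // scale0r.
rewrite mulr_sumr coef_sum mulrBr mulr1 coefB coefMXn !coef_ternary_poly.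
have lt_nN : (n %/ R < N)%N by have := leq_div n R; rewrite /N; lia.
have coefC j : ((\sum_(m < P) 'X^m : {poly int}) * (1 - 'X^Q))`_j
    = (j < P)%N%:R - (Q <= j < Q + P)%N%:R.
  have E i : (\sum_(m < P) 'X^m : {poly int})`_i = (i < P)%N%:R.
    have -> : \sum_(m < P) 'X^m = \poly_(m < P) (1 : int).
      by rewrite poly_def; apply: eq_bigr => m _; rewrite scale1r.
    by rewrite coef_poly; case: ifP.
  rewrite mulrBr mulr1 coefB coefMXn !E; case: (ltnP j Q) => hj //=.
  by rewrite ltn_subLR.
have -> : (if (n < P * Q)%N then 0 else trunc_coef (n - P * Q)%N%:Z ((n - P * Q) %/ R).+1) =
   \sum_(z < N) (if (R * z + P * Q <= n)%N then
     bin_poly`_z * ((window (n%:Z - (R * z)%N%:Z))%:R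
                    - (window (n%:Z - (R * z)%N%:Z - Q%:Z))%:R) else 0).
  case: ltnP => hn.
    by rewrite big1 // => z _; case: ifP => // h; lia.
  have -> : (n - P * Q)%N%:Z = n%:Z + (-1) * (P * Q)%N%:Z by lia.
  rewrite trunc_coefD (@trunc_coef_widen _ _ N); last first.
    by apply: leq_ltn_trans lt_nN; apply: leq_div2r; rewrite leq_subr.
  by apply: eq_bigr => z _; rewrite leq_subRL // addnC.
rewrite (@trunc_coef_widen _ _ N) // -sumrB; apply: eq_bigr => z _.
rewrite -scalerAr coefZ coefMXn coefC.
case: (ltnP n (R * z)) => [h|h].
  by have /negPf-> : ~~ (R * z + P * Q <= n)%N; [lia | rewrite subr0 mulr0].
have -> : n%:Z - (R * z)%N%:Z = (n - R * z)%N%:Z by lia.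
have [hlt|hge] := ltnP (n - R * z) (P * Q).
  have /negPf-> : ~~ (R * z + P * Q <= n)%N by lia.
  by rewrite subr0 window_small // window_smallB.
have -> : (R * z + P * Q <= n)%N by lia.
rewrite subrr; have /negPf-> : ~~ (n - R * z < P)%N by lia.
by have /negPf-> : ~~ (Q <= n - R * z < Q + P)%N; [lia | rewrite subrr mulr0].
Qed.

Lemma ternary_incl_exclE : ternary_incl_excl P Q R = ternary_poly.
Proof.
have [P3 hPQ _ _] := PQ_facts; have R0 := R_gt0.
rewrite /ternary_incl_excl.
set den := (X in _ %/ X).
have den_monic : den \is monic.
  by rewrite /den !monicMl ?monicXsubC // ?(monicXnsubC 1) ?muln_gt0 //; lia.
rewrite -[RHS](Pdiv.IdomainMonic.mulpK den_monic); congr (_ %/ _).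
have := congr1 (fun f => f \Po 'X^R) bin_polyE.
rewrite !rmorphM !rmorphB /= !rmorphXn /= comp_polyX !rmorph1 -!exprM => E.
have E2 := ternary_polyE.
have E3 := subrX1 ('X : {poly int}) P.
transitivity (- ((ternary_poly * (1 - 'X^(P * Q))) *
   (('X^(Q * R) - 1) * ('X^(R * P) - 1) * ('X - 1)))); last by rewrite /den; ring.
rewrite E2.
transitivity ((('X - 1) * (\sum_(m < P) 'X^m)) * ('X^Q - 1) *
  ((bin_poly \Po 'X^R) * ('X^(R * P) - 1) * ('X^(R * Q) - 1))); last first.
  by rewrite (mulnC R Q); ring.
by rewrite E -E3 (mulnC R (P * Q)); ring.
Qed.

(** * Realizing every value in the range *)

Lemma window_progression (f : nat) :
  (P * Q %| 2 * R + 1)%N || (P * Q %| 2 * R - 1)%N ->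
  exists c : int, forall m, (m < P)%N -> window (c - (R * (f + 2 * m))%N%:Z).
Proof.
have [P3 hPQ hS _] := PQ_facts; have R0 := R_gt0.
case/orP=> /dvdnP[u Eu].
  (* Here [- 2 * R * m] is [m] modulo [P * Q]. *)
  exists (R * f)%N%:Z => m hm; rewrite -(windowD _ (u * m)%N).
  have -> : (R * f)%N%:Z - (R * (f + 2 * m))%N%:Z + (u * m)%N%:Z * (P * Q)%N%:Z = m%:Z.
    by rewrite -PoszM mulnAC -Eu; lia.
  by rewrite window_small //; lia.
(* Here [- 2 * R * m] is [- m], so the window is traversed downwards from [P - 1]. *)
exists ((R * f)%N%:Z + P%:Z - 1) => m hm; rewrite -(windowD _ (u * m)%N).
have -> : (R * f)%N%:Z + P%:Z - 1 - (R * (f + 2 * m))%N%:Z + (u * m)%N%:Z * (P * Q)%N%:Z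
    = (P - 1 - m)%N%:Z.
  by rewrite -PoszM mulnAC -Eu mulnBl; have := leq_mul R0 (leqnn m); lia.
by rewrite window_small; lia.
Qed.

(** The interval from [R * t] to [R * t + R] has length at least [P * Q], hence contains an index
    congruent to [c]. *)
Lemma trunc_coef_mem c t : exists2 i, (R * t <= i)%N & ternary_poly`_i = trunc_coef c t.+1.
Proof.
have [P3 hPQ hS _] := PQ_facts; have R0 := R_gt0.
have PQ0 : (P * Q)%N%:Z != 0 by lia.
pose j := ((c - (R * t)%N%:Z) %% (P * Q)%N%:Z)%Z.
have j0 : 0 <= j by apply: modz_ge0.
have jlt : j < (P * Q)%N%:Z by apply: ltz_pmod; lia.
exists (R * t + `|j|)%N; first exact: leq_addr.
rewrite coef_ternary_poly mulnC divnMDl // divn_small ?addn0; last by lia.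
rewrite -(trunc_coefD _ ((c - (R * t)%N%:Z) %/ (P * Q)%N%:Z)%Z); congr trunc_coef.
by have := divz_eq (c - (R * t)%N%:Z) (P * Q)%N%:Z; rewrite -/j; lia.
Qed.

Theorem coef_set_optimal :
  (P * Q %| 2 * R + 1)%N || (P * Q %| 2 * R - 1)%N ->
  coef_set P Q R =i [pred n : int | - s%:Z <= n <= s.+1%:Z].
Proof.
move=> hR n; have [P3 hPQ hS _] := PQ_facts; have R0 := R_gt0.
have t_gt1 : (1 < k * s * P + P)%N by lia.
rewrite !inE ternary_incl_exclE; apply/idP/idP => [/(nthP 0)[i _ <-]|].
  by rewrite coef_ternary_poly trunc_coef_bound.
have mem_coef i : ternary_poly`_i != 0 -> (i < size ternary_poly)%N.
  by apply: contraNltn => h; rewrite nth_default.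
have mem_trunc c t : trunc_coef c t != 0 -> trunc_coef c t \in (ternary_poly : seq int).
  case: t => [|t]; first by rewrite /trunc_coef big_ord0 eqxx.
  have [i _ <-] := trunc_coef_mem c t => ne.
  exact/mem_nth/mem_coef.
have [c1 h1] := window_progression (k * s * P) hR.
have [c2 h2] := window_progression (k * s * P + 1) hR.
have max := trunc_coef_max h1; have min := trunc_coef_min h2.
have trunc0 c : trunc_coef c 0%N = 0 by rewrite /trunc_coef big_ord0.
case/andP=> n_ge n_le; case: (ltrgt0P n) => [n0|n0|->].
- have [||t Et] := @discrete_ivt (trunc_coef c1) (k * s * P + P) n.
  + exact: trunc_coef_step.
  + by rewrite trunc0 max n_le ltW.
  by rewrite -Et mem_trunc // Et gt_eqF.
- have [||t Et] := @discrete_ivt (fun t => - trunc_coef c2 t) (k * s * P + P) (- n).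
  + by move=> t; rewrite -opprD normrN trunc_coef_step.
  + by rewrite trunc0 min opprK oppr0 oppr_ge0 (ltW n0) lerNl.
  by rewrite -(oppr_inj Et) mem_trunc // (oppr_inj Et) lt_eqF.
(* The value 0 needs a vanishing coefficient below the degree. The coefficient at [P] vanishes, and
   the maximal coefficient sits at a higher index. *)
have [i le_i Ei] := trunc_coef_mem c1 (k * s * P + P).-1.
rewrite prednK ?(ltnW t_gt1) // max in Ei.
have lt_P : (P < size ternary_poly)%N.
  apply: leq_ltn_trans (mem_coef i _); last by rewrite Ei.
  apply: leq_trans le_i; apply: leq_trans (leq_pmulr _ _); lia.
suff <- : ternary_poly`_P = 0 by apply: mem_nth.
rewrite coef_ternary_poly divn_small; last by lia.
rewrite /trunc_coef big_ord1 muln0 subr0 window_small; last by lia.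
rewrite window_smallB; last by lia.
have lt_PQ : (P < Q)%N by lia.
by rewrite ltnn leqNgt lt_PQ subrr mulr0.
Qed.

End TernaryCoefficients.
(** * Choice of the exponents *)

(** The primitive root property as a congruence in [nat], convenient when the modulus varies. *)
Definition order_totient_mod (g n : nat) : Prop :=
  forall i, (g ^ i == 1 %[mod n])%N = (totient n %| i)%N.

Lemma primitive_root_mod_order (g n : nat) : (1 < n)%N ->
  primitive_root_mod g n -> order_totient_mod g n.
Proof.
move=> n_gt1 prim i; rewrite (prim_order_dvd prim) -natrX.
by rewrite -val_eqE /= val_Zp_nat // (modn_small n_gt1).
Qed.

Lemma order_totient_mod_coprime (g n : nat) : (1 < n)%N ->
  order_totient_mod g n -> coprime g n.
Proof.
move=> n_gt1 /(_ (totient n)); rewrite dvdnn => /eqP h.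
have tn : (0 < totient n)%N by rewrite totient_gt0 ltnW.
rewrite -(coprime_pexpl _ _ tn) -coprime_modl h coprime_modl; exact: coprime1n.
Qed.

(** By counting: the powers with exponent below [totient n] are distinct units, and there are
    [totient n] units. *)
Lemma order_totient_mod_surj (g n u : nat) : (1 < n)%N -> order_totient_mod g n ->
  coprime n u -> exists i, (g ^ i = u %[mod n])%N.
Proof.
move=> n_gt1 ord_g co_nu; have n_gt0 := ltnW n_gt1.
have co_gn := order_totient_mod_coprime n_gt1 ord_g.
pose f (i : 'I_(totient n)) : 'I_n := Ordinal (ltn_pmod (g ^ i) n_gt0).
have f_inj : injective f.
  suff W (i j : 'I_(totient n)) : (i <= j)%N -> f i = f j -> i = j.
    by move=> i j Eij; have [/W|/ltnW/W h] := leqP i j; [exact | exact/esym/h].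
  move=> le_ij /(congr1 val)/= /eqP; rewrite eq_sym eqn_mod_dvd ?leq_pexp2l //; last first.
    by rewrite lt0n; apply: contraTneq co_gn => ->; rewrite /coprime gcd0n gtn_eqF.
  rewrite -[(g ^ j)%N](congr1 (expn g) (subnKC le_ij)) expnD -{2}[(g ^ i)%N]muln1 -mulnBr.
  rewrite Gauss_dvdr; last by rewrite coprime_sym coprimeXl.
  rewrite -eqn_mod_dvd ?expn_gt0; last first.
    by rewrite lt0n; case: eqP co_gn => // ->; rewrite /coprime gcd0n gtn_eqF.
  rewrite ord_g => /dvdnP[[|m] Em]; apply/val_inj => /=; first by lia.
  by have := ltn_ord j; have := ltn_ord i; lia.
pose A := [set x : 'I_n | coprime n x].
have cardA : #|A| = totient n.
  rewrite totient_count_coprime big_mkord -sum1dep_card big_mkcond /=.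
  by apply: eq_bigr => x _; case: ifP.
have imA : [set f i | i : 'I_(totient n)] = A.
  apply/eqP; rewrite eqEcard cardA card_imset // card_ord leqnn andbT.
  apply/subsetP => _ /imsetP[i _ ->]; rewrite inE /=.
  by rewrite coprime_modr coprime_sym coprimeXl.
have : Ordinal (ltn_pmod u n_gt0) \in A by rewrite inE /= coprime_modr.
by rewrite -imA => /imsetP[i _ /(congr1 val)/= ->]; exists i.
Qed.

(** * Primitive roots modulo powers of an odd prime *)

Lemma geom_sum_mod_sqr (p x : nat) : odd p -> (x = 1 %[mod p])%N -> (0 < x)%N ->
  exists2 v, coprime p v & (\sum_(i < p) x ^ i = p * v)%N.
Proof.
move=> p_odd /eqP; rewrite eq_sym => h x_gt0; move: h.
rewrite eq_sym eqn_mod_dvd // => /dvdnP[t Et].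
have Ex : x = (1 + p * t)%N by lia.
have p_gt0 : (0 < p)%N by case: (p) p_odd.
have pow i : exists m, (x ^ i = 1 + i * (p * t) + p ^ 2 * m)%N.
  elim: i => [|i [m Em]]; first by exists 0%N; rewrite expn0 muln0.
  exists (m + i * t ^ 2 + m * (p * t))%N; rewrite expnS Em Ex; nia.
have [F hF] := fin_all_exists (fun i : 'I_p => pow i).
pose M := (\sum_(i < p) F i)%N.
(* Modulo [p ^ 2], [x ^ i] is [1 + i * p * t]; for odd [p] the sum of the [i] is [p * p./2], so the
   linear terms vanish and only [p] remains. *)
exists (1 + p * (p./2 * t + M))%N.
  by rewrite addnC mulnC coprime_sym /coprime gcdnC gcdnMDl gcdn1.
rewrite (eq_bigr _ (fun i _ => hF i)) 2!big_split /= sum_nat_const card_ord muln1.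
rewrite -big_distrl -big_distrr /= -/M.
have -> : (\sum_(i < p) i = p * p./2)%N.
  rewrite -(big_mkord xpredT id) bin2_sum bin2.
  have Ep : p = (p./2.*2 + 1)%N by rewrite -{1}(odd_double_half p) p_odd addnC.
  by rewrite {2}Ep addn1 /= -doubleMr doubleK.
by nia.
Qed.

(** The cofactor of [x - 1] in [x ^ p - 1] is a geometric sum divisible by [p] exactly once. *)
Lemma expn_prime_mod_desc (p x a : nat) : prime p -> odd p ->
  (x = 1 %[mod p])%N -> (0 < x)%N ->
  (p ^ a.+1 %| x ^ p - 1)%N = (p ^ a %| x - 1)%N.
Proof.
move=> p_pr p_odd x1 x_gt0; have [v co_pv Ev] := geom_sum_mod_sqr p_odd x1 x_gt0.
rewrite subn1 predn_exp Ev subn1 mulnCA expnS dvdn_pmul2l ?prime_gt0 //.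
by rewrite Gauss_dvdl // coprimeXl.
Qed.

(** If [g ^ i] is 1 modulo [p], then [g ^ (i * p)] is 1 modulo [p ^ 2], so [p * (p - 1)] divides
    [i * p]. *)
Lemma order_totient_mod_prime (p g : nat) : prime p -> odd p ->
  order_totient_mod g (p ^ 2) -> order_totient_mod g p.
Proof.
move=> p_pr p_odd ord2 i; have p_gt1 := prime_gt1 p_pr; have p_gt0 := ltnW p_gt1.
have p2 : (1 < p ^ 2)%N by rewrite (ltn_exp2l 0).
have co := order_totient_mod_coprime p2 ord2.
have cop : coprime g p by move: co; rewrite coprime_pexpr.
have g_gt0 : (0 < g)%N.
  by rewrite lt0n; apply: contraTneq cop => ->; rewrite /coprime gcd0n gtn_eqF.
apply/idP/idP => [h|/dvdnP[m ->]]; last first.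
  by rewrite mulnC expnM -modnXm Euler_exp_totient // modnXm exp1n.
have x0 : (0 < g ^ i)%N by rewrite expn_gt0 g_gt0.
have : (g ^ (i * p) == 1 %[mod p ^ 2])%N.
  rewrite expnM eqn_mod_dvd ?(expn_gt0, g_gt0) // (@expn_prime_mod_desc p _ 1) //; last exact/eqP.
  by rewrite expn1 -eqn_mod_dvd.
rewrite ord2 totient_pfactor //= expn1 totient_prime // dvdn_pmul2r //.
Qed.

Lemma order_totient_mod_pfactor (p g a : nat) : prime p -> odd p ->
  order_totient_mod g (p ^ 2) -> (0 < a)%N -> order_totient_mod g (p ^ a).
Proof.
move=> p_pr p_odd ord2 a_gt0.
have p_gt1 := prime_gt1 p_pr; have p_gt0 := ltnW p_gt1.
have ord1 := order_totient_mod_prime p_pr p_odd ord2.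
have cop := order_totient_mod_coprime p_gt1 ord1.
have g_gt0 : (0 < g)%N.
  by rewrite lt0n; apply: contraTneq cop => ->; rewrite /coprime gcd0n gtn_eqF.
case: a a_gt0 => // -[_|a _]; first by rewrite expn1.
elim: a => [//|a IH] i; apply/idP/idP => [h|/dvdnP[m ->]]; last first.
  by rewrite mulnC expnM -modnXm Euler_exp_totient ?coprimeXr // modnXm exp1n.
have : (g ^ i == 1 %[mod p ^ a.+2])%N.
  by move: h; rewrite !eqn_mod_dvd ?(expn_gt0, g_gt0) //; apply: dvdn_trans; rewrite dvdn_exp2l.
rewrite IH totient_pfactor //= expnSr mulnA => /dvdnP[m Em].
(* One factor [p] is split off [i]; [i'] is still a multiple of [p - 1], so [g ^ i'] is 1 modulo [p]
   and the exponent of [p] can be lowered. *)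
pose i' := (m * (p.-1 * p ^ a))%N.
have Ei : i = (i' * p)%N by rewrite Em /i'; ring.
have x0 : (0 < g ^ i')%N by rewrite expn_gt0 g_gt0.
have x1 : (g ^ i' == 1 %[mod p])%N.
  by rewrite ord1 totient_prime // /i' dvdn_mull // dvdn_mulr.
move: h; rewrite Ei expnM eqn_mod_dvd ?(expn_gt0, g_gt0) //.
rewrite expn_prime_mod_desc //; last exact/eqP.
rewrite -eqn_mod_dvd // IH !totient_pfactor //= (expnSr p a.+1) mulnA.
by rewrite dvdn_pmul2r.
Qed.

(* Euler's argument with a square root [J] of -1: compare
   [(1 + J) ^+ p = 1 + J ^+ p] with [(1 + J) ^+ p = (1 + J) * (2 J) ^+ (p-1)/2]. *)
Lemma two_exp_half (p : nat) : prime p -> (p %% 4 = 3)%N ->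
  (2%:R : 'F_p) ^+ (p.-1./2) = (-1) ^+ (p %% 8 == 3)%N.
Proof.
move=> p_pr p3; set N := p.-1./2.
(* As -1 is not a square in ['F_p], its square root is taken among matrices, a substitute for the
   quadratic extension. *)
pose J : 'M['F_p]_2 := \matrix_(i, j) (if i == j then 0 else if i == 0 then 1 else -1).
have JJ : J * J = -1.
  apply/matrixP => i j; rewrite !mxE big_ord_recl big_ord1 !mxE.
  by case: i => [[|[|//]] ?]; case: j => [[|[|//]] ?];
     rewrite /= ?mul0r ?mulr0 ?mulrN1 ?mulN1r ?mulr1 ?addr0 ?add0r ?oppr0.
have JX n : J ^+ (n * 4) = 1.
  by rewrite mulnC exprM -[4%N]/(2 * 2)%N exprM [J ^+ 2]expr2 JJ sqrrN !expr1n.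
have J3 : J ^+ 3 = - J by rewrite exprS expr2 JJ mulrN1.
have Jmod1 n : (n %% 4 = 1)%N -> J ^+ n = J.
  by move=> h; rewrite (divn_eq n 4) h exprD JX mul1r.
have Jmod3 n : (n %% 4 = 3)%N -> J ^+ n = - J.
  by move=> h; rewrite (divn_eq n 4) h exprD JX mul1r J3.
have pch : p \in [pchar 'M['F_p]_2] by rewrite pchar_lalg pchar_Fp.
have Ep : (1 + J) ^+ p = 1 - J.
  have -> : (1 + J) ^+ p = pFrobenius_aut pch (1 + J) by [].
  rewrite pFrobenius_autD_comm; last exact: commr_sym (commr1 _).
  rewrite pFrobenius_aut1; congr (_ + _).
  exact: Jmod3.
have EN : p = N.*2.+1.
  by rewrite /N; lia.
have sq : (1 + J) ^+ 2 = J *+ 2.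
  by rewrite expr2 mulrDl mul1r mulrDr mulr1 JJ addrC addrA subrK mulr2n.
have EN2 : (1 + J) ^+ p = ((1 + J) * J ^+ N) *+ 2 ^ N.
  transitivity ((1 + J) ^+ N.*2.+1); first by congr (_ ^+ _).
  by rewrite exprS -mul2n exprM sq exprMn_n mulrnAr.
have key : ((-1) ^+ (p %% 8 == 7)%N * 2%:R ^+ N : 'F_p) *: (J - 1) = 1 - J.
  rewrite -Ep EN2.
  have -> : J ^+ N = (-1) ^+ (p %% 8 == 7)%N * J.
    have [p8|p8] : (p %% 8 = 3 \/ p %% 8 = 7)%N by lia.
      by rewrite Jmod1 ?p8 /= ?mul1r // /N; lia.
    by rewrite Jmod3 ?p8 /= ?mulN1r // /N; lia.
  rewrite -natrX; case: (_ == 7)%N; rewrite /= ?expr1 ?expr0 ?mulN1r ?mul1r.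
    by rewrite scaleNr scaler_nat mulrN mulrDl mul1r JJ mulNrn.
  by rewrite scaler_nat mulrDl mul1r JJ.
have := congr1 (fun M : 'M_2 => M 0 0) key; rewrite !mxE /= sub0r subr0 mulrN1 => E.
have [p8|p8] : (p %% 8 = 3 \/ p %% 8 = 7)%N by lia.
  by move: E; rewrite p8 /= mul1r => /(congr1 -%R); rewrite opprK.
by move: E; rewrite p8 /= mulN1r opprK.
Qed.

(** Raise [2 * r ^ i = (-1) ^ e] to the power [(p - 1) / 2], which is odd: [r] becomes -1 and 2
    becomes its quadratic character. *)
Lemma index_parity (p r i : nat) (e : bool) : prime p -> (p %% 4 = 3)%N ->
  order_totient_mod r p -> (p%:Z %| (2 * r ^ i)%N%:Z - (-1) ^+ e)%Z ->
  odd i = (p %% 8 == 3)%N (+) e.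
Proof.
move=> p_pr p3 ord_r; pose N := p.-1./2.
have pch := pchar_Fp p_pr.
have p_gt1 := prime_gt1 p_pr.
have r_gt0 : (0 < r)%N.
  rewrite lt0n; apply: contraTneq (order_totient_mod_coprime p_gt1 ord_r) => ->.
  by rewrite /coprime gcd0n gtn_eqF.
have r1 m : ((r%:R : 'F_p) ^+ m == 1) = (p.-1 %| m)%N.
  rewrite -totient_prime // -ord_r eqn_mod_dvd ?expn_gt0 ?r_gt0 //.
  by rewrite (dvdn_pcharf pch) natrB ?expn_gt0 ?r_gt0 // natrX subr_eq0.
have rN : (r%:R : 'F_p) ^+ N = -1.
  have : ((r%:R : 'F_p) ^+ N) ^+ 2 == 1.
    by rewrite -exprM r1 [(N * 2)%N](_ : _ = p.-1) // /N; lia.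
  rewrite sqrf_eq1 r1 => /orP[/dvdnP[m Em]|/eqP //].
  by case: m Em => [|m]; rewrite /N; nia.
rewrite (dvdz_pcharf pch) rmorphB rmorphXn /= rmorphN1 subr_eq0 => /eqP.
rewrite -pmulrn natrM natrX => /(congr1 (fun z => z ^+ N)).
rewrite exprMn two_exp_half // -exprM mulnC exprM rN -exprM mulnC exprM.
have -> : (-1 : 'F_p) ^+ N = -1.
  by rewrite -signr_odd (_ : odd N) ?expr1 // /N; lia.
rewrite -(signr_odd _ i) -signr_addb.
have ne : (-1 : 'F_p) != 1.
  by rewrite eq_sym -addr_eq0 -[1 + 1]/(2%:R) -(dvdn_pcharf pch) gtnNdvd //; lia.
by case: (_ == 3)%N; case: (odd i); case: e => //= /eqP;
   rewrite ?expr0 ?expr1 ?(negPf ne) // eq_sym (negPf ne).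
Qed.

(** * Simultaneous congruences for the exponents *)

Lemma chinese_same_parity (m n i j M : nat) : gcdn m n = 2%N -> (0 < m)%N -> (0 < n)%N ->
  odd i = odd j ->
  exists c, [/\ (M <= c)%N, (c = i %[mod m])%N & (c = j %[mod n])%N].
Proof.
move=> gcd_mn m0 n0 oij.
have Em : m = (2 * (m %/ 2))%N by rewrite mulnC divnK // -gcd_mn dvdn_gcdl.
have En : n = (2 * (n %/ 2))%N by rewrite mulnC divnK // -gcd_mn dvdn_gcdr.
set m' := (m %/ 2)%N in Em; set n' := (n %/ 2)%N in En.
have co : coprime m' n'.
  by rewrite /coprime -(eqn_pmul2l (isT : (0 < 2)%N)) muln_gcdr -Em -En gcd_mn.
pose c0 := chinese m' n' i./2 j./2.
(* The common parity is removed and the rest solved modulo the coprime halves; the last summand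
   makes the solution large. *)
exists (odd i + 2 * c0 + M * (m * n))%N; split.
- apply: leq_trans (leq_addl _ _); apply: leq_pmulr; rewrite muln_gt0; exact/andP.
- rewrite [(m * n)%N]mulnC mulnA addnC modnMDl -{2}(odd_double_half i).
  rewrite -modnDmr -[in RHS]modnDmr -mul2n; congr ((_ + _) %% _)%N.
  by rewrite Em -!muln_modr chinese_modl.
rewrite mulnA addnC modnMDl -{1}(odd_double_half j) oij.
rewrite -modnDmr -[in RHS]modnDmr -mul2n; congr ((_ + _) %% _)%N.
by rewrite En -!muln_modr chinese_modr.
Qed.

Lemma order_totient_mod_exp (g n i j : nat) : order_totient_mod g n ->
  (i = j %[mod totient n])%N -> (g ^ i = g ^ j %[mod n])%N.
Proof.
move=> ord_g; suff red k : (g ^ k = g ^ (k %% totient n) %[mod n])%N.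
  by move=> Eij; rewrite red Eij -red.
have /eqP g1 : (g ^ totient n == 1 %[mod n])%N by rewrite ord_g.
rewrite {1}(divn_eq k (totient n)) [(k %/ _ * _)%N]mulnC expnD expnM -modnMml -modnXm g1 modnXm exp1n.
by rewrite modnMml mul1n.
Qed.

(** The prime powers drop out: [p] does not divide [q - 1] by assumption, nor [q] divide [p - 1] by
    size. *)
Lemma gcdn_totient_pfactor (p q a b : nat) : prime p -> prime q -> (p < q)%N ->
  (0 < a)%N -> (0 < b)%N -> ~~ (p %| q.-1)%N ->
  gcdn (totient (p ^ a)) (totient (q ^ b)) = gcdn p.-1 q.-1.
Proof.
move=> p_pr q_pr lt_pq a0 b0 ndvd; rewrite !totient_pfactor //.
have p_gt1 := prime_gt1 p_pr.
have co1 : coprime p q by rewrite prime_coprime // dvdn_prime2 // ltn_eqF.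
have co2 : coprime p q.-1 by rewrite prime_coprime.
have co3 : coprime q p.-1 by rewrite prime_coprime // gtnNdvd //; lia.
rewrite Gauss_gcdl; last by rewrite coprimeXr // coprimeMl coprime_sym co3 coprimeXl.
rewrite gcdnC Gauss_gcdl; first exact: gcdnC.
by rewrite coprime_sym coprimeXl.
Qed.

Lemma half_mod (n : nat) (e : bool) : odd n -> (2 < n)%N ->
  exists2 u, coprime n u & (n%:Z %| (2 * u)%N%:Z - (-1) ^+ e)%Z.
Proof.
move=> n_odd n_gt2; have En : n = (n./2.*2 + 1)%N by rewrite -{1}(odd_double_half n) n_odd addnC.
suff [u hu] : exists u, (n%:Z %| (2 * u)%N%:Z - (-1) ^+ e)%Z.
  exists u => //; rewrite /coprime eqn_leq gcdn_gt0 (ltn_trans _ n_gt2) //= andbT.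
  have : (gcdn n u %| 1)%N.
    have d1 : ((gcdn n u)%:Z %| (2 * u)%N%:Z - (-1) ^+ e)%Z.
      by apply: dvdz_trans hu; rewrite dvdzE /= dvdn_gcdl.
    have d2 : ((gcdn n u)%:Z %| (2 * u)%N%:Z)%Z by rewrite dvdzE /= dvdn_mull // dvdn_gcdr.
    have : ((gcdn n u)%:Z %| (-1) ^+ e)%Z.
      by rewrite -(rpredBl ((-1) ^+ e) d2).
    by case: (e).
  by rewrite dvdn1 => /eqP->.
case: e; [exists n./2 | exists n./2.+1]; apply/dvdzP; exists 1;
  rewrite ?expr1 ?expr0; lia.
Qed.

Lemma dvdz_half_eqmod (n u v : nat) (e : bool) : (u = v %[mod n])%N ->
  (n%:Z %| (2 * u)%N%:Z - (-1) ^+ e)%Z -> (n%:Z %| (2 * v)%N%:Z - (-1) ^+ e)%Z.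
Proof.
move=> Euv h.
have -> : (2 * v)%N%:Z - (-1) ^+ e =
    ((2 * u)%N%:Z - (-1) ^+ e) - (2 * ((u %/ n)%:Z - (v %/ n)%:Z)) * n%:Z.
  have := divn_eq u n; have := divn_eq v n; rewrite Euv; set c := (-1) ^+ e; nia.
by rewrite rpredB // dvdz_mull.
Qed.

Lemma rat_range (s : nat) (n : int) :
  (- (((2 * s + 1)%N%:R - 1) / 2) <= (n%:~R : rat) <= ((2 * s + 1)%N%:R + 1) / 2)
  = (- s%:Z <= n <= s.+1%:Z).
Proof.
have -> : ((2 * s + 1)%N%:R - 1) / 2 = (s%:Z)%:~R :> rat.
  by rewrite natrD natrM -pmulrn; field.
have -> : ((2 * s + 1)%N%:R + 1) / 2 = (s.+1%:Z)%:~R :> rat.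
  by rewrite natrD natrM -pmulrn -addn1 natrD; field.
by rewrite -mulrNz !ler_int.
Qed.

(** * Assembling the exponents *)

Theorem theorem3 (p q r : nat)
  (p_prime : prime p) (q_prime : prime q) (r_prime : prime r)
  (lt_pq : (p < q)%N)
  (pq_mod8 : (p = 3 %[mod 8] /\ q = 3 %[mod 8]) \/
             (p = 7 %[mod 8] /\ q = 7 %[mod 8]))
  (gcd_pq : gcdn (p - 1) (q - 1) = 2%N)
  (q_root_p : primitive_root_mod q (p ^ 2))
  (r_root_p : primitive_root_mod r (p ^ 2))
  (r_root_q : primitive_root_mod r (q ^ 2)) :
  forall a : nat, (1 <= a)%N ->
  exists b c : nat,
    [/\ (1 <= b)%N, (1 <= c)%N &
        coef_set (p ^ a) (q ^ b) (r ^ c) =i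
        [pred n : int | - (((p ^ a)%:R - 1) / 2) <= (n%:~R : rat)
                                               <= ((p ^ a)%:R + 1) / 2]].
Proof.
move=> a a_gt0.
have p4 : (p %% 4 = 3)%N by clear -pq_mod8; lia.
have q4 : (q %% 4 = 3)%N by clear -pq_mod8; lia.
have p_odd : odd p by clear -p4; lia.
have q_odd : odd q by clear -q4; lia.
have p_gt2 : (2 < p)%N by clear -p4; lia.
have [p_gt1 q_gt1] := (prime_gt1 p_prime, prime_gt1 q_prime).
have p2_gt1 : (1 < p ^ 2)%N by rewrite (ltn_exp2l 0).
have q2_gt1 : (1 < q ^ 2)%N by rewrite (ltn_exp2l 0).
have ordqp := primitive_root_mod_order p2_gt1 q_root_p.
have ordrp := primitive_root_mod_order p2_gt1 r_root_p.
have ordrq := primitive_root_mod_order q2_gt1 r_root_q.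
set P := (p ^ a)%N.
have P_gt2 : (2 < P)%N.
  by apply: leq_trans p_gt2 _; rewrite -{1}(expn1 p) leq_pexp2l // prime_gt0.
have P_odd : odd P by rewrite oddX p_odd orbT.
have [b Eb] : exists b, (q ^ b = 2 %[mod P])%N.
  apply: order_totient_mod_surj; first exact: ltnW.
    exact: order_totient_mod_pfactor.
  by rewrite coprimeXl // coprime_sym coprime2n.
have b_gt0 : (0 < b)%N.
  by rewrite lt0n; apply/eqP => b0; move: Eb; rewrite b0 expn0 !modn_small // ltnW.
set Q := (q ^ b)%N in Eb.
have Q_gt2 : (2 < Q)%N.
  by apply: leq_trans p_gt2 _; apply: leq_trans (ltnW lt_pq) _; rewrite -{1}(expn1 q) leq_pexp2l // prime_gt0.
have Q_odd : odd Q by rewrite oddX q_odd orbT.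
pose s := P./2; pose k := (Q %/ P)%N.
have defP : P = (2 * s + 1)%N by rewrite -{1}(odd_double_half P) P_odd /s addnC mul2n.
have defQ : Q = (k * P + 2)%N by rewrite {1}(divn_eq Q P) Eb (modn_small P_gt2).
have s_gt0 : (0 < s)%N by clear -defP P_gt2; lia.
have k_gt0 : (0 < k)%N by move: defQ Q_gt2; case: (k) => // ->.
(* The sign of [2 * R] modulo [P * Q]: -1 goes with [w = 2], but [P = 3] has [s = 1] and forces
   [w = 1], whence the sign +1. *)
pose e := (P != 3)%N.
have [u co_u hu] := half_mod e P_odd P_gt2.
have [v co_v hv] := half_mod e Q_odd Q_gt2.
have ordP : order_totient_mod r P by exact: order_totient_mod_pfactor.
have ordQ : order_totient_mod r Q by exact: order_totient_mod_pfactor.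
have [i Ei] := order_totient_mod_surj (ltnW P_gt2) ordP co_u.
have [j Ej] := order_totient_mod_surj (ltnW Q_gt2) ordQ co_v.
have oij : odd i = odd j.
  rewrite (@index_parity p r i e) //; first rewrite (@index_parity q r j e) //.
  - by congr (_ (+) _); clear -pq_mod8; lia.
  - exact: order_totient_mod_prime.
  - apply: dvdz_trans (dvdz_half_eqmod (esym Ej) hv).
    by rewrite dvdzE /= dvdn_exp.
  - exact: order_totient_mod_prime.
  apply: dvdz_trans (dvdz_half_eqmod (esym Ei) hu).
  by rewrite dvdzE /= dvdn_exp.
have gcd_tot : gcdn (totient P) (totient Q) = 2%N.
  rewrite gcdn_totient_pfactor -?subn1 ?gcd_pq //.
  (* If [p] divided [q - 1], then [q] would be 1 modulo [p], against its order [p - 1 > 1]. *)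
  rewrite -eqn_mod_dvd ?prime_gt0 //.
  rewrite -{1}(expn1 q) (order_totient_mod_prime p_prime p_odd ordqp).
  by rewrite totient_prime // gtnNdvd // -ltnS prednK // prime_gt0.
have [||c [le_c Ec1 Ec2]] := chinese_same_parity (P * Q) gcd_tot _ _ oij.
- by rewrite totient_gt0 (ltn_trans _ P_gt2).
- by rewrite totient_gt0 (ltn_trans _ Q_gt2).
have PQ_gt0 : (0 < P * Q)%N by rewrite muln_gt0 (ltn_trans _ P_gt2) ?(ltn_trans _ Q_gt2).
have c_gt0 : (0 < c)%N by apply: leq_trans le_c.
exists b, c; split => //.
rewrite -/P -/Q; set R := (r ^ c)%N.
(* The lower bound [P * Q] imposed on [c] serves here, through [c < r ^ c]. *)
have le_R : (P * Q <= R)%N by apply: leq_trans le_c (ltnW (ltn_expl _ (prime_gt1 r_prime))).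
have hRP : (P%:Z %| (2 * R)%N%:Z - (-1) ^+ e)%Z.
  by apply: dvdz_half_eqmod hu; rewrite -Ei; apply/esym/order_totient_mod_exp.
have hRQ : (Q%:Z %| (2 * R)%N%:Z - (-1) ^+ e)%Z.
  by apply: dvdz_half_eqmod hv; rewrite -Ej; apply/esym/order_totient_mod_exp.
have coPQ : coprime P Q.
  by rewrite coprimeXl // coprimeXr // prime_coprime // dvdn_prime2 // ltn_eqF.
have hR : ((P * Q)%N%:Z %| (2 * R)%N%:Z - (-1) ^+ e)%Z.
  by rewrite (PoszM P Q) Gauss_dvdz // hRP hRQ.
have coRQ : coprime R Q.
  exact/coprimeXl/(order_totient_mod_coprime (ltnW Q_gt2) ordQ).
have R_gt0 : (0 < R)%N by apply: leq_trans le_R.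
have hR' : (P * Q %| 2 * R + 1)%N || (P * Q %| 2 * R - 1)%N.
  move: hR; case: (e) => h; apply/orP; [left|right].
    by move: h; rewrite expr1 opprK dvdzE.
  move: h; rewrite expr0 (_ : (2 * R)%N%:Z - 1 = (2 * R - 1)%N%:Z) ?dvdzE //; clear -R_gt0; lia.
pose w := (if e then 2 else 1)%N.
have w_gt0 : (0 < w)%N by rewrite /w; case: (e).
have le_ws : (w <= s)%N by rewrite /w /e; case: eqP => /= h; clear -defP P_gt2 h; lia.
have hw : (P %| R * w + 1)%N.
  move: hRP; rewrite /w /e; case: eqP => /= h; last first.
    by rewrite expr1 opprK dvdzE /= mulnC.
  by rewrite h expr0; clear; lia.
move=> n; rewrite (coef_set_optimal s_gt0 k_gt0 defP defQ w_gt0 le_ws hw coRQ le_R hR').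
by rewrite !inE defP rat_range.
Qed.
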